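(* Let $k \geq 0$ be an integer and let $G=(X,Y;E)$ be a bipartite graph with parts $X$ and $Y$ such that $\Delta(X) = 2$ and $\Delta(Y) = 2k+1$. Then $\chi'_{st}(G) \leq 3k+2$.
   Context: For a bipartite graph $G=(X,Y;E)$ with parts $X$, $Y$, $\Delta(X)$ and $\Delta(Y)$ denote the maximum degree of the vertices in $X$ and in $Y$, respectively. A star edge coloring of a graph is a proper edge coloring in which there is no path or cycle of length four (i.e., with four edges) whose edges use only two colors. The star chromatic index $\chi'_{st}(G)$ is the minimum number $t$ such that $G$ has a star edge coloring with $t$ colors. *)

(* Defs.v *)
(* MathComp; graphs are finite and simple. *)
From mathcomp Require Import all_boot.
Set Implicit Arguments.
Unset Strict Implicit.
Unset Printing Implicit Defensive.

Record sgraph := SGraph {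
  vertex :> finType;
  adj : rel vertex;
  adj_sym : symmetric adj;
  adj_irr : irreflexive adj
}.

Definition edges (G : sgraph) : {set {set G}} :=
  [set e : {set G} | [exists x, exists y, adj x y && (e == [set x; y])]].

Definition edge (G : sgraph) : finType := {e : {set G} | e \in edges G}.

Definition degree (G : sgraph) (x : G) : nat := #|[set y | adj x y]|.

Definition max_degree (G : sgraph) (A : {set G}) : nat :=
  \max_(x in A) degree x.

Definition bipartition (G : sgraph) (X Y : {set G}) : Prop :=
  [/\ X :|: Y = [set: G], [disjoint X & Y] &
      forall x y : G, adj x y ->
        (x \in X) && (y \in Y) || (x \in Y) && (y \in X)].

Section StarEdgeColoring.
Variable G : sgraph.

(* The vertex pairs {x, p_1}, {p_1, p_2}, ... traversed by the walk x :: p. *)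
Definition walk_edges (x : G) (p : seq G) : seq {set G} :=
  pairmap (fun u v => [set u; v]) x p.

Definition colors_on (t : nat) (c : {ffun edge G -> 'I_t}) (s : seq {set G}) :
    {set 'I_t} :=
  [set c e | e : edge G & val e \in s].

Definition proper_edge_coloring (t : nat) (c : {ffun edge G -> 'I_t}) : bool :=
  [forall e, forall f,
     (e != f) && (val e :&: val f != set0) ==> (c e != c f)].

(* A path with four edges has five distinct vertices x, p_1, ..., p_4; a cycle
   with four edges has four distinct vertices x, p_1, p_2, p_3 and is closed by
   walking back to x. *)
Definition star_edge_coloring (t : nat) (c : {ffun edge G -> 'I_t}) : bool :=
  [&& proper_edge_coloring c,
      [forall x : G, forall p : 4.-tuple G,
         path (@adj G) x p && uniq (x :: p) ==>
           ~~ (#|colors_on c (walk_edges x p)| <= 2)] &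
      [forall x : G, forall p : 3.-tuple G,
         cycle (@adj G) (x :: p) && uniq (x :: p) ==>
           ~~ (#|colors_on c (walk_edges x (rcons p x))| <= 2)]].

Definition star_edge_colorable (t : nat) : bool :=
  [exists c : {ffun edge G -> 'I_t}, star_edge_coloring c].

Lemma pair_in_edges (x y : G) : adj x y -> [set x; y] \in edges G.
Proof.
by move=> xy; rewrite inE; apply/existsP; exists x; apply/existsP; exists y;
   rewrite xy eqxx.
Qed.

Lemma colors_on_inj (t : nat) (c : {ffun edge G -> 'I_t}) (x y z w : G)
    (s : seq {set G}) :
  injective c -> adj x y -> adj y z -> adj z w -> uniq [:: x; y; z; w] ->
  {subset [:: [set x; y]; [set y; z]; [set z; w]] <= s} ->
  2 < #|colors_on c s|.
Proof.
move=> cI xy yz zw; rewrite /= !inE !negb_or -!andbA.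
case/and5P=> nxy nxz nxw nyz /and3P[nyw nzw _] sub.
pose e1 : edge G := exist (fun e => e \in edges G) _ (pair_in_edges xy).
pose e2 : edge G := exist (fun e => e \in edges G) _ (pair_in_edges yz).
pose e3 : edge G := exist (fun e => e \in edges G) _ (pair_in_edges zw).
have x1 : x \in val e1 by rewrite !inE eqxx.
have x2 : x \notin val e2 by rewrite !inE negb_or nxy nxz.
have x3 : x \notin val e3 by rewrite !inE negb_or nxz nxw.
have y2 : y \in val e2 by rewrite !inE eqxx.
have y3 : y \notin val e3 by rewrite !inE negb_or nyz nyw.
have n12 : e1 != e2 by apply: contraNneq x2 => <-.
have n13 : e1 != e3 by apply: contraNneq x3 => <-.
have n23 : e2 != e3 by apply: contraNneq y3 => <-.
have u : uniq [:: c e1; c e2; c e3].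
  by rewrite /= !inE !(inj_eq cI) negb_or n12 n13 n23.
rewrite -[3]/(size [:: c e1; c e2; c e3]) -(card_uniqP u).
apply: subset_leq_card; apply/subsetP=> a.
by rewrite !inE => /or3P[] /eqP->; apply: imset_f; rewrite inE; apply: sub;
   rewrite !inE eqxx ?orbT.
Qed.

Lemma ex_star_edge_colorable : exists t, star_edge_colorable t.
Proof.
exists #|edge G|; apply/existsP.
pose c : {ffun edge G -> 'I_#|edge G|} := [ffun e => enum_rank e].
have cI : injective c by move=> e f; rewrite !ffunE; apply: enum_rank_inj.
exists c; apply/and3P; split.
- apply/forallP=> e; apply/forallP=> f; apply/implyP=> /andP[nef _].
  by rewrite (inj_eq cI).
- apply/forallP=> x; apply/forallP=> -[[|y [|z [|w [|v []]]]] //= sz].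
  apply/implyP=> /andP[/and5P[xy yz zw _ _] u]; rewrite -ltnNge.
  apply: (colors_on_inj cI xy yz zw); last first.
    by move=> a; rewrite !inE => /or3P[] ->; rewrite ?orbT.
  by apply: (@subseq_uniq _ _ [:: x; y; z; w; v]) => //=; rewrite !eqxx.
- apply/forallP=> x; apply/forallP=> -[[|y [|z [|w []]]] //= sz].
  apply/implyP=> /andP[/and5P[xy yz zw _ _] u]; rewrite -ltnNge.
  apply: (colors_on_inj cI xy yz zw) => //.
  by move=> a; rewrite !inE => /or3P[] ->; rewrite ?orbT.
Qed.

Definition star_chromatic_index : nat := ex_minn ex_star_edge_colorable.

End StarEdgeColoring.

(* Main.v *)
Require Import Defs.
From mathcomp Require Import all_boot.
From mathcomp Require Import zify.

(* View G as a multigraph H on Y whose edges are the vertices of X, so that the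
   edges of G are the half-edges of H.

   If H has maximum degree 2k, then 3k colours suffice: orient H with all in-
   and out-degrees at most k, and by Konig's theorem split the arcs into k
   classes consisting of directed paths and cycles. Each class gets its own
   three colours: the heads of the arcs are coloured so that consecutive arcs
   differ, and the tail of an arc avoids the head colours of that arc and of its
   predecessor. The colour at the head of an arc u -> v is then missing at u,
   which excludes bicoloured paths and cycles of length four.

   If H has maximum degree 2k+1 with k > 0, take a maximum cut z of H. Every
   vertex of degree 2k+1 has at least k+1 >= 2 half-edges crossing the cut;
   choosing two of them at each such vertex and properly 2-colouring the chosen
   edges of G (they form paths and even cycles), one colour class is a matching
   M of crossing half-edges that covers all vertices of degree 2k+1. Colour
   G - M with 3k colours, and m in M with one of two new colours given by the
   side of the cut containing its end in Y. As M crosses the cut, no edge of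
   G - M joins two edges of M of the same colour. *)
Set Implicit Arguments.
Unset Strict Implicit.
Unset Printing Implicit Defensive.

(** * Bipartite multigraphs of maximum degree two *)

Section Fibers.
Variable D : finType.
Implicit Types (A B : {set D}).

(** Think of [D] as the edges of a bipartite multigraph and of [h] as one of its two end maps:
    [fiber_le] bounds the degrees on that side, [fiber_inj] is properness of a colouring there. *)
Definition fiber_le (S : eqType) (n : nat) A (h : D -> S) : Prop :=
  forall s, #|[set d in A | h d == s]| <= n.

Definition fiber_inj (S C : eqType) A (h : D -> S) (c : D -> C) : Prop :=
  {in A &, forall d d', h d = h d' -> c d = c d' -> d = d'}.

Lemma fiber_leS (S : eqType) n A B (h : D -> S) :
  A \subset B -> fiber_le n B h -> fiber_le n A h.
Proof.
move=> sAB hB s; apply: leq_trans (hB s); apply: subset_leq_card.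
by apply/subsetP=> d; rewrite !inE => /andP[/(subsetP sAB)-> ->].
Qed.

Lemma fiber_le2P (S : eqType) A (h : D -> S) :
  fiber_le 2 A h <->
  {in A & &, forall a b d, h a = h b -> h a = h d ->
     [|| a == b, a == d | b == d]}.
Proof.
split=> [h2 a b d Aa Ab Ad hab had | h3 s].
  apply/negPn/negP; rewrite !negb_or => /and3P[nab nad nbd].
  have := h2 (h a); rewrite leqNgt => /negP[]; apply/card_gt2P.
  exists a, b, d; split; first by rewrite !inE ?Aa ?Ab ?Ad -hab -had eqxx.
  by rewrite nab nbd eq_sym nad.
rewrite leqNgt; apply/negP=> /card_gt2P[a [b [d [[]]]]].
rewrite !inE => /andP[Aa /eqP <-] /andP[Ab /eqP hb] /andP[Ad /eqP hd].
case=> nab nbd nda; have := h3 a b d Aa Ab Ad (esym hb) (esym hd).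
by rewrite (negbTE nab) (negbTE nbd) eq_sym (negbTE nda).
Qed.

Lemma fiber_inj_ext (S C : eqType) A e (h : D -> S) (c : D -> C) v :
  fiber_inj (A :\ e) h c ->
  {in A :\ e, forall d, h d = h e -> c d != v} ->
  fiber_inj A h (fun d => if d == e then v else c d).
Proof.
move=> hc hv d d' Ad Ad' hdd'.
case: (eqVneq d e) => [de|nde]; case: (eqVneq d' e) => [de'|nde'].
- by rewrite de de'.
- move=> E; have /hv : d' \in A :\ e by rewrite !inE nde'.
  by rewrite E -hdd' de eqxx => /(_ erefl).
- move=> E; have /hv : d \in A :\ e by rewrite !inE nde.
  by rewrite E hdd' de' eqxx => /(_ erefl).
- by apply: hc => //; rewrite !inE ?nde ?nde'.
Qed.

(** Sides alternate along a cycle, so all cycles are even. The induction deletes an edge [e]. If at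
    most one other edge meets [e], a colour is free for [e]; otherwise a path of three edges is
    shortened to one, which changes [l] but keeps parity. *)
Lemma two_coloring (S S' : eqType) A (l : D -> S) (r : D -> S') :
  fiber_le 2 A l -> fiber_le 2 A r ->
  exists c : D -> bool, fiber_inj A l c /\ fiber_inj A r c.
Proof.
elim/ltn_ind: {A}#|A| {-2}A (erefl #|A|) l => n IH A cA l Al Ar.
have [->|[e Ae]] := set_0Vmem A.
  by exists (fun=> true); split=> d d'; rewrite inE.
have A1n : #|A :\ e| < n by rewrite -cA [X in _ < X](cardsD1 e) Ae.
have sA1 : A :\ e \subset A by apply: subD1set.
have extend (c : D -> bool) v : fiber_inj (A :\ e) l c -> fiber_inj (A :\ e) r c ->
    {in A :\ e, forall d, l d = l e -> c d != v} ->
    {in A :\ e, forall d, r d = r e -> c d != v} ->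
    exists c : D -> bool, fiber_inj A l c /\ fiber_inj A r c.
  move=> lc rc lv rv; exists (fun d => if d == e then v else c d).
  by split; apply: fiber_inj_ext.
have other (T : eqType) (h : D -> T) a : fiber_le 2 A h -> a \in A :\ e ->
    h a = h e -> {in A :\ e, forall d, h d = h e -> d = a}.
  move=> /fiber_le2P h2 /setD1P[nae Aa] hae d /setD1P[nde Ad] hde.
  have := h2 e a d Ae Aa Ad (esym hae) (esym hde).
  by rewrite eq_sym (negbTE nae) eq_sym (negbTE nde) => /eqP.
have [c [lc rc]] := IH _ A1n _ erefl _ (fiber_leS sA1 Al) (fiber_leS sA1 Ar).
have [a /andP[A1a /eqP lae]|noa] :=
    pickP [pred a | (a \in A :\ e) && (l a == l e)]; last first.
  have [b /andP[A1b /eqP rbe]|nob] :=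
      pickP [pred b | (b \in A :\ e) && (r b == r e)].
    apply: (extend c (~~ c b) lc rc) => d A1d /eqP de.
      by have := noa d; rewrite /= A1d de.
    by rewrite (other _ r b Ar A1b rbe d A1d (eqP de)); case: (c b).
  apply: (extend c true lc rc) => d A1d /eqP de.
    by have := noa d; rewrite /= A1d de.
  by have := nob d; rewrite /= A1d de.
have [b /andP[A1b /eqP rbe]|nob] :=
    pickP [pred b | (b \in A :\ e) && (r b == r e)]; last first.
  apply: (extend c (~~ c a) lc rc) => d A1d /eqP de.
    by rewrite (other _ l a Al A1a lae d A1d (eqP de)); case: (c a).
  by have := nob d; rewrite /= A1d de.
have [eab|nab] := eqVneq a b.
  apply: (extend c (~~ c a) lc rc) => d A1d de.
    by rewrite (other _ l a Al A1a lae d A1d de); case: (c a).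
  by rewrite eab (other _ r b Ar A1b rbe d A1d de); case: (c b).
(* Suppress [e] and [b] from the path a, e, b, and let [a] take over the
   remaining [l]-neighbour of [b]. *)
pose l' d := if d == a then l b else l d.
have A2n : #|(A :\ e) :\ b| < n.
  by apply: leq_trans A1n; rewrite [X in _ < X.+1](cardsD1 b) A1b; lia.
have sA2 : (A :\ e) :\ b \subset A by apply: subset_trans sA1; apply: subD1set.
have lab : l a != l b.
  apply/eqP=> lab; move: nab; rewrite eq_sym.
  by rewrite (other _ l a Al A1a lae b A1b) ?eqxx // -lab.
have [nbe Ab] := setD1P A1b.
have Al' : fiber_le 2 ((A :\ e) :\ b) l'.
  apply/fiber_le2P=> x y z; rewrite !inE => /and3P[xb xe Ax] /and3P[yb ye Ay].
  case/and3P=> zb ze Az; move/fiber_le2P: Al => Al; rewrite /l'.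
  have Hb u v : u \in A -> v \in A -> u != b -> v != b -> l u = l b -> l v = l b ->
      u == v.
    move=> Au Av ub vb lu lv; have := Al b u v Ab Au Av (esym lu) (esym lv).
    by rewrite eq_sym (negbTE ub) eq_sym (negbTE vb).
  case: (eqVneq x a) => xa; case: (eqVneq y a) => ya; case: (eqVneq z a) => za;
    rewrite ?xa ?ya ?za ?eqxx ?orbT // => E1 E2.
  - by rewrite (Hb y z) ?orbT.
  - by rewrite (Hb x z) ?orbT // -E2.
  - by rewrite (Hb x y) // -E1.
  - exact: Al.
have [c' [lc' rc']] := IH _ A2n _ erefl _ Al' (fiber_leS sA2 Ar).
(* The shortened graph put [a] in the place of [b], so [b] inherits the colour of [a], and [e]
   between them gets the opposite one. *)
pose c1 d := if d == b then c' a else c' d.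
have A2a : a \in (A :\ e) :\ b by rewrite in_setD1 nab.
apply: (extend c1 (~~ c' a)).
- apply: fiber_inj_ext => [x y A2x A2y|x A2x lxb].
    have onlya u : u \in (A :\ e) :\ b -> l u = l a -> u = a.
      by move=> /setD1P[_ A1u] lu; exact: (other _ l a Al A1a lae u A1u (etrans lu lae)).
    case: (eqVneq x a) => [->|xa]; first by move=> /esym/(onlya y A2y)->.
    case: (eqVneq y a) => [->|ya]; first by move=> /(onlya x A2x)->.
    move=> lxy; apply: lc' => //.
    by rewrite /l' (negbTE xa) (negbTE ya).
  apply/eqP=> cxa; have xa : x = a.
    by apply: lc' => //; rewrite /l' eqxx lxb; case: eqP.
  by move: lab; rewrite -xa lxb eqxx.
- apply: fiber_inj_ext => // x A2x rxb; have [xb A1x] := setD1P A2x.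
  by rewrite (other _ r b Ar A1b rbe x A1x) ?eqxx ?rxb in xb.
- move=> d A1d ld; rewrite (other _ l a Al A1a lae d A1d ld) /c1.
  by rewrite (negbTE nab); case: (c' a).
- move=> d A1d rd; rewrite (other _ r b Ar A1b rbe d A1d rd) /c1 eqxx.
  by case: (c' a).
Qed.

End Fibers.

(** * Konig's edge-colouring theorem and greedy colouring *)

Lemma avoid (s : seq nat) n : size s < n -> exists2 a, a < n & a \notin s.
Proof.
move=> sn; case: (altP (@allP _ (mem s) (iota 0 n))) => [sub|].
  have := uniq_leq_size (iota_uniq 0 n) sub.
  by rewrite size_iota leqNgt sn.
by case/allPn=> a; rewrite mem_iota => an ans; exists a.
Qed.

(** Fewer than [k] other edges meet [e] at each end, so a colouring of the rest leaves some [a] free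
    at the [l]-end of [e] and some [b] free at its [r]-end. *)
Lemma konig (D : finType) (S S' : eqType) k (A : {set D})
    (l : D -> S) (r : D -> S') :
  fiber_le k A l -> fiber_le k A r ->
  exists f : D -> nat,
    [/\ {in A, forall d, f d < k}, fiber_inj A l f & fiber_inj A r f].
Proof.
elim/ltn_ind: {A}#|A| {-2}A (erefl #|A|) => n IH A cA Al Ar.
have [->|[e Ae]] := set_0Vmem A.
  by exists (fun=> 0); split=> [d|d d'|d d']; rewrite inE.
have A1n : #|A :\ e| < n by rewrite -cA [X in _ < X](cardsD1 e) Ae.
have sA1 : A :\ e \subset A by apply: subD1set.
have [f [fk fl fr]] := IH _ A1n _ erefl (fiber_leS sA1 Al) (fiber_leS sA1 Ar).
have missing (T : eqType) (h : D -> T) : fiber_le k A h ->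
    exists2 a, a < k & {in A :\ e, forall d, h d = h e -> f d != a}.
  move=> Ah; pose F := [set d in A :\ e | h d == h e].
  have Fk : size [seq f d | d <- enum F] < k.
    rewrite size_map -cardE; apply: leq_trans (Ah (h e)).
    apply: proper_card; apply/properP; split.
      by apply/subsetP=> d; rewrite !inE => /andP[/andP[_ ->] ->].
    by exists e; rewrite !inE ?Ae eqxx.
  have [a ak aF] := avoid Fk; exists a => // d A1d hd.
  apply: contraNneq aF => <-; apply: map_f.
  by rewrite mem_enum inE A1d hd eqxx.
have [a ak al] := missing _ l Al; have [b bk br] := missing _ r Ar.
have [ab|nab] := eqVneq a b.
  exists (fun d => if d == e then a else f d); split.
  - by move=> d Ad; case: eqVneq => // nde; apply: fk; rewrite !inE nde.
  - exact: fiber_inj_ext.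
  - by apply: fiber_inj_ext => //; rewrite ab.
(* Recolouring everything coloured [a] or [b] together with [e] by means of
   [two_coloring] replaces the switch along a Kempe chain. *)
pose E := [set d in A | (d == e) || (f d == a) || (f d == b)].
(* As [v] is free at this end of [e], at most one other edge of [E] meets [e] there; any other
   vertex meets at most one edge of each of the two colours. *)
have E2 (T : eqType) (h : D -> T) v : fiber_inj (A :\ e) h f ->
    {in A :\ e, forall d, h d = h e -> f d != v} -> (v == a) || (v == b) ->
    fiber_le 2 E h.
  move=> fh fv vab; apply/fiber_le2P.
  have two x y : x \in E -> y \in E -> x != e -> y != e ->
      h x = h e -> h y = h e -> x == y.
    rewrite !inE => /andP[Ax cx] /andP[Ay cy] xe ye hx hy.
    have A1x : x \in A :\ e by rewrite !inE xe.
    have A1y : y \in A :\ e by rewrite !inE ye.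
    have := fv x A1x hx; have := fv y A1y hy.
    move: cx cy; rewrite (negbTE xe) (negbTE ye) /= => cx cy ny nx.
    apply/eqP; apply: fh; rewrite ?hx ?hy //; apply/eqP; lia.
  move=> x y z Ex Ey Ez hxy hxz.
  have [xe|xe] := eqVneq x e.
    have [|ye] := eqVneq y e; first by rewrite xe => ->; rewrite eqxx.
    have [|ze] := eqVneq z e; first by rewrite xe => ->; rewrite eqxx orbT.
    by rewrite (two y z) ?orbT // -?hxy -?hxz xe.
  have [ye|ye] := eqVneq y e.
    have [|ze] := eqVneq z e; first by rewrite ye => ->; rewrite eqxx !orbT.
    by rewrite (two x z) ?orbT // -?hxz ?hxy ye.
  have [ze|ze] := eqVneq z e.
    by rewrite (two x y) // -?hxy hxz ze.
  move: Ex Ey Ez; rewrite !inE (negbTE xe) (negbTE ye) (negbTE ze) /=.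
  move=> /andP[Ax cx] /andP[Ay cy] /andP[Az cz].
  have A1x : x \in A :\ e by rewrite !inE xe.
  have A1y : y \in A :\ e by rewrite !inE ye.
  have A1z : z \in A :\ e by rewrite !inE ze.
  have [fxy|nxy] := eqVneq (f x) (f y); first by rewrite (fh x y) ?eqxx.
  have [fxz|nxz] := eqVneq (f x) (f z).
    by rewrite (fh x z) ?eqxx ?orbT.
  by rewrite (fh y z) ?eqxx ?orbT -?hxy //; lia.
have El : fiber_le 2 E l by apply: (E2 _ l a fl al); rewrite eqxx.
have Er : fiber_le 2 E r by apply: (E2 _ r b fr br); rewrite eqxx orbT.
have [c [cl cr]] := two_coloring El Er.
exists (fun d => if d \in E then if c d then a else b else f d).
(* Outside [E] the colours [a] and [b] do not occur, so no clash arises between [E] and its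
   complement. *)
have rest d : d \in A -> d \notin E -> [/\ d \in A :\ e, f d != a & f d != b].
  by move=> Ad; rewrite !inE Ad /= !negb_or => /andP[/andP[-> ->] ->].
have inj (T : eqType) (h : D -> T) : fiber_inj (A :\ e) h f -> fiber_inj E h c ->
    fiber_inj A h (fun d => if d \in E then if c d then a else b else f d).
  move=> fh ch d d' Ad Ad' hdd'; have [Ed|Ed] := boolP (d \in E).
    have [Ed'|Ed'] := boolP (d' \in E).
      move=> cdd'; apply: ch => //; move: cdd' nab.
      by case: (c d) (c d') => [] [] // ->; rewrite eqxx.
    by have [_ na nb] := rest _ Ad' Ed'; case: (c d); lia.
  have [A1d na nb] := rest _ Ad Ed; have [Ed'|Ed'] := boolP (d' \in E).
    by case: (c d'); lia.
  by have [A1d' _ _] := rest _ Ad' Ed'; apply: fh.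
split; [|exact: inj|exact: inj].
move=> d Ad; case: ifP => [_|/negbT Ed]; first by case: ifP.
by have [A1d _ _] := rest _ Ad Ed; apply: fk.
Qed.

(** Among the [n + 1] values one is always free. Degrees count both directions of [R], which will be
    the succession of arcs. *)
Lemma greedy_coloring (T : finType) (R : rel T) n :
  irreflexive R -> (forall x, #|[set y | R x y || R y x]| <= n) ->
  exists m : T -> nat, (forall x, m x <= n) /\ forall x y, R x y -> m x != m y.
Proof.
move=> irr deg.
suff ext (A : {set T}) : exists m : T -> nat, (forall x, m x <= n) /\
    {in A &, forall x y, R x y -> m x != m y}.
  have [m [mn mR]] := ext [set: T].
  by exists m; split=> // x y; apply: mR; rewrite inE.
elim/ltn_ind: {A}#|A| {-2}A (erefl #|A|) => N IH A cA.
have [->|[t At]] := set_0Vmem A.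
  by exists (fun=> 0); split=> // x y; rewrite inE.
have A1N : #|A :\ t| < N by rewrite -cA [X in _ < X](cardsD1 t) At.
have [m [mn mR]] := IH _ A1N _ erefl.
have sz : size [seq m y | y <- enum [set y | R t y || R y t]] < n.+1.
  by rewrite size_map -cardE ltnS.
have [a an na] := avoid sz.
have aR y : R t y || R y t -> m y != a.
  move=> Ry; apply: contraNneq na => <-; apply: map_f.
  by rewrite mem_enum inE.
exists (fun x => if x == t then a else m x); split=> [x|x y Ax Ay].
  by case: ifP.
case: (eqVneq x t) => [->|xt]; case: (eqVneq y t) => [->|yt].
- by rewrite irr.
- by move=> Rty; rewrite eq_sym aR // Rty.
- by move=> Rxt; rewrite aR // Rxt orbT.
- by apply: mR; rewrite !inE ?xt ?yt.
Qed.

(** * Half-edges [d] of H, with edge [px d] and end [py d]; [pxy_inj] excludes loops *)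

Section HalfEdges.
Variables (D U V : finType) (px : D -> U) (py : D -> V).
Hypothesis pxy_inj : forall d d', px d = px d' -> py d = py d' -> d = d'.
Implicit Types (A B M : {set D}).

(** Pairing the half-edges at each vertex splits it into vertices of degree at most two; a proper
    2-colouring then puts at most one head and one tail in each pair. The value [true] will mark
    tails. *)
Lemma balanced_orientation A k :
  fiber_le 2 A px -> fiber_le k.*2 A py ->
  exists o : D -> bool, fiber_inj A px o /\
    forall b, fiber_le k [set d in A | o d == b] py.
Proof.
move=> Ax Ay; pose F v := enum [set d in A | py d == v].
have F_mem d : d \in A -> d \in F (py d) by move=> Ad; rewrite mem_enum inE Ad /=.
pose rk d := index d (F (py d)).
have rk_inj d d' : d \in A -> d' \in A -> py d = py d' -> rk d = rk d' -> d = d'.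
  move=> Ad Ad' E; rewrite /rk -E; apply: (index_inj d); first exact: F_mem.
  by rewrite E F_mem.
have rk_lt d : d \in A -> rk d < k.*2.
  move=> Ad; apply: leq_trans (Ay (py d)).
  by rewrite cardE index_mem F_mem.
(* Ranks 2i and 2i+1 at a vertex form a pair. *)
pose r d := (py d, (rk d)./2).
have Ar : fiber_le 2 A r.
  apply/fiber_le2P=> x y z Ax' Ay' Az [exy hxy] [exz hxz].
  have [xy|nxy] := eqVneq (rk x) (rk y); first by rewrite (rk_inj x y) ?eqxx.
  have [xz|nxz] := eqVneq (rk x) (rk z); first by rewrite (rk_inj x z) ?eqxx ?orbT.
  by rewrite (rk_inj y z) ?eqxx ?orbT -?exy //; lia.
have [o [ox or]] := two_coloring Ax Ar.
exists o; split=> // b v; set S := [set _ in _ | _].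
have inS d : d \in S -> [/\ d \in A, o d = b & py d = v].
  by rewrite !inE => /andP[/andP[-> /eqP->] /eqP->].
(* Half-edges of equal direction at [v] lie in different pairs, and there are at most [k] pairs. *)
have u : uniq [seq (rk d)./2 | d <- enum S].
  rewrite map_inj_in_uniq ?enum_uniq // => d d'; rewrite !mem_enum.
  move=> /inS[Ad od vd] /inS[Ad' od' vd'] h.
  by apply: or; rewrite /r ?vd ?vd' ?h ?od.
rewrite cardE -(size_map (fun d => (rk d)./2)) -[k in _ <= k](size_iota 0).
apply: uniq_leq_size => // a /mapP[d]; rewrite mem_enum => /inS[Ad _ _] ->.
by rewrite mem_iota; have := rk_lt d Ad; lia.
Qed.

(** Konig's theorem is applied to the bipartite graph in which each arc joins the tail copy of one
    vertex to the head copy of another. In a colour class at most one arc leaves and at most one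
    enters each vertex. *)
Lemma oriented_classes A (o : D -> bool) k :
  0 < k -> fiber_inj A px o ->
  (forall b, fiber_le k [set d in A | o d == b] py) ->
  exists f : U -> nat, (forall x, f x < k) /\
    {in A &, forall d d', o d = o d' -> py d = py d' -> f (px d) = f (px d') ->
      d = d'}.
Proof.
move=> k_gt0 ox oy.
(* A missing end of [x] is replaced by the private vertex [inr x]. *)
pose pt b x : V + U :=
  if [pick d in A | (px d == x) && (o d == b)] is Some d then inl (py d) else inr x.
have ptE d : d \in A -> pt (o d) (px d) = inl (py d).
  move=> Ad; rewrite /pt; case: pickP => [d' /and3P[Ad' /eqP xd' /eqP od']|].
    by rewrite (ox d' d).
  by move/(_ d); rewrite Ad !eqxx.
have pt_le b : fiber_le k [set: U] (pt b).
  case=> [v|x].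
    apply: leq_trans (oy b v); apply: leq_trans (leq_imset_card px _).
    apply: subset_leq_card; apply/subsetP=> x; rewrite !inE /= /pt.
    case: pickP => // d /and3P[Ad /eqP xd od] vd; apply/imsetP; exists d => //.
    by rewrite !inE Ad od.
  (* A private vertex has degree at most one, which [0 < k] allows. *)
  apply: leq_trans k_gt0; rewrite -(cards1 x); apply: subset_leq_card.
  apply/subsetP=> x'; rewrite !inE /= /pt; case: pickP => // _.
have [f [fk ft ff]] := konig (pt_le true) (pt_le false).
exists f; split=> [x|d d' Ad Ad' odd' ydd' fdd']; first by apply: fk; rewrite inE.
have E : pt (o d) (px d) = pt (o d) (px d').
  by rewrite ptE // odd' ptE // ydd'.
apply: ox => //; move: E; case: (o d) => E.
  by apply: ft; rewrite ?inE.
by apply: ff; rewrite ?inE.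
Qed.

(** * Star colourings for maximum degree 2k *)

Definition alternating_free (S S' : eqType) A (h : D -> S) (g : D -> S')
    (c : D -> nat) : Prop :=
  forall d1 d2 d3 d4, d1 \in A -> d2 \in A -> d3 \in A -> d4 \in A ->
    d1 != d2 -> d2 != d3 -> d3 != d4 ->
    h d1 = h d2 -> g d2 = g d3 -> h d3 = h d4 ->
    c d1 = c d3 -> c d2 <> c d4.

(** The middle vertex of a four-edge walk may lie on either side, hence both orders of [px] and
    [py]. The walk may close up, so 4-cycles are covered too. *)
Definition star_coloring A (c : D -> nat) : Prop :=
  [/\ fiber_inj A px c, fiber_inj A py c,
      alternating_free A px py c & alternating_free A py px c].

Lemma star_coloring_even A k :
  0 < k -> fiber_le 2 A px -> fiber_le k.*2 A py ->
  exists c : D -> nat, (forall d, c d < 3 * k) /\ star_coloring A c.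
Proof.
move=> k_gt0 Ax Ay; have [o [ox oy]] := balanced_orientation Ax Ay.
have [f [fk f_inj]] := oriented_classes k_gt0 ox oy.
(* The arc [x] follows the arc [x'] inside one class. *)
pose R x' x := (f x' == f x) && [exists d', exists d,
  [&& d' \in A, d \in A, px d' == x', px d == x, ~~ o d', o d & py d' == py d]].
have RP d' d : d' \in A -> d \in A -> ~~ o d' -> o d -> py d' = py d ->
    f (px d') = f (px d) -> R (px d') (px d).
  move=> Ad' Ad od' od y fe; rewrite /R fe eqxx; apply/existsP; exists d'.
  by apply/existsP; exists d; rewrite Ad' Ad od' od y !eqxx.
have RE x' x : R x' x -> f x' = f x /\ exists d' d, [/\ d' \in A, d \in A &
    [/\ px d' = x', px d = x, ~~ o d', o d & py d' = py d]].
  case/andP=> /eqP-> /existsP[d' /existsP[d]].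
  case/and5P=> Ad' Ad /eqP x1 /eqP x2 /and3P[o1 o2 /eqP y].
  by split=> //; exists d', d.
(* An arc following itself would be a loop. *)
have Rirr : irreflexive R.
  move=> x; apply/negP=> /RE[_ [d' [d [_ _ [x1 x2 o1 o2 y]]]]].
  by move: o1; rewrite (pxy_inj (etrans x1 (esym x2)) y) o2.
have Rpred x' x'' x : R x' x -> R x'' x -> x' = x''.
  move=> /RE[f1 [d1 [e1 [A1 B1 [xa xe1 o1 oe1 y1]]]]].
  move=> /RE[f2 [d2 [e2 [A2 B2 [xb xe2 o2 oe2 y2]]]]].
  have e12 : e1 = e2 by apply: ox; rewrite ?xe1 ?oe1 ?oe2.
  rewrite -xa -xb; congr px; apply: f_inj => //; first by rewrite (negbTE o1) (negbTE o2).
    by rewrite y1 e12.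
  by rewrite xa xb f1 f2.
have Rsucc x x' x'' : R x x' -> R x x'' -> x' = x''.
  move=> /RE[f1 [d1 [e1 [A1 B1 [xe1 xa o1 oe1 y1]]]]].
  move=> /RE[f2 [d2 [e2 [A2 B2 [xe2 xb o2 oe2 y2]]]]].
  have e12 : d1 = d2 by apply: ox; rewrite ?xe1 // (negbTE o1) (negbTE o2).
  rewrite -xa -xb; congr px; apply: f_inj => //; first by rewrite oe1 oe2.
    by rewrite -y1 -y2 e12.
  by rewrite xa xb -f1 -f2.
have deg1 (P : pred U) : (forall x y, P x -> P y -> x = y) -> #|[set x | P x]| <= 1.
  by move=> P1; apply/card_le1_eqP=> x y; rewrite !inE => Px Py; apply: P1.
(* One predecessor and one successor at most, so three values suffice for the heads. *)
have deg x : #|[set y | R x y || R y x]| <= 2.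
  have -> : [set y | R x y || R y x] = [set y | R x y] :|: [set y | R y x].
    by apply/setP=> y; rewrite !inE.
  apply: leq_trans (leq_card_setU _ _) _; rewrite -[2]/(1 + 1).
  by apply: leq_add; apply: deg1 => y z; [apply: Rsucc|apply: Rpred].
have [eta [eta3 etaR]] := greedy_coloring Rirr deg.
(* The tail has at most two head values to avoid, as the predecessor is unique. *)
have /fin_all_exists[tau tauP] x : exists t,
    [/\ t < 3, t != eta x & forall x', R x' x -> t != eta x'].
  have sz : size (eta x :: [seq eta x' | x' <- enum [set x' | R x' x]]) < 3.
    by rewrite /= size_map -cardE !ltnS deg1 // => y z; apply: Rpred.
  have [t t3] := avoid sz; rewrite inE negb_or => /andP[tx tR].
  exists t; split=> // x' Rx'; apply: contraNneq tR => ->; apply: map_f.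
  by rewrite mem_enum inE.
pose s d := if o d then tau (px d) else eta (px d).
(* Class i owns the colours 3i, 3i+1 and 3i+2. *)
pose c d := 3 * f (px d) + s d.
have s3 d : s d < 3.
  by rewrite /s; case: (o d); [case: (tauP (px d))|rewrite ltnS eta3].
have cE d d' : c d = c d' -> f (px d) = f (px d') /\ s d = s d'.
  by rewrite /c; have := s3 d; have := s3 d'; lia.
have cx : fiber_inj A px c.
  move=> d d' Ad Ad' xdd' /cE[_]; rewrite /s xdd'.
  have [_ /eqP tn _] := tauP (px d').
  case od: (o d); case od': (o d') => E; try by apply: ox; rewrite ?od ?od'.
  by case: tn.
have s_diff d d' : d \in A -> d' \in A -> o d -> ~~ o d' -> py d = py d' ->
    f (px d) = f (px d') -> [/\ tau (px d) != eta (px d') & eta (px d') != eta (px d)].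
  move=> Ad Ad' od od' y fe; have r : R (px d') (px d) by apply: RP.
  by have [_ _ ->] := tauP (px d); rewrite // etaR.
have cy : fiber_inj A py c.
  move=> d d' Ad Ad' ydd' /cE[fe]; rewrite /s.
  case od: (o d); case od': (o d') => E; try by apply: f_inj; rewrite ?od ?od'.
    have [|] := s_diff d d' Ad Ad' od _ ydd' fe; first by rewrite od'.
    by rewrite E eqxx.
  have [|] := s_diff d' d Ad' Ad od' _ (esym ydd') (esym fe); first by rewrite od.
  by rewrite E eqxx.
(* At the tail vertex [py d] the class of the arc has only the tail [d] and possibly the head of the
   predecessor; both avoid the head colour of the arc. *)
have head_missing d d2 d1 : d \in A -> d2 \in A -> d1 \in A -> o d ->
    px d = px d2 -> d != d2 -> py d1 = py d -> c d1 <> c d2.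
  move=> Ad Ad2 Ad1 od x nd y /cE[fe].
  have od2 : o d2 = false.
    by apply/negP=> od2; case/eqP: nd; apply: ox => //; rewrite od od2.
  rewrite /s od2 -x; case od1: (o d1).
    have -> : d1 = d by apply: f_inj; rewrite ?od ?od1 // fe x.
    by have [_ /eqP] := tauP (px d).
  have fe1 : f (px d) = f (px d1) by rewrite fe x.
  by have [_ /eqP] := s_diff d d1 Ad Ad1 od (negbT od1) (esym y) fe1.
exists c; split.
  by move=> d; rewrite /c; have := s3 d; have := fk (px d); lia.
split=> //.
(* The middle is a vertex of H. If [d2] or [d3] is a tail, the head colour of its arc is missing
   there; two heads of one class cannot meet. *)
- move=> d1 d2 d3 d4 A1 A2 A3 A4 n12 n23 n34 x12 y23 x34 c13 c24.
  case o2: (o d2).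
    by apply: (head_missing d2 d1 d3) => //; rewrite eq_sym.
  case o3: (o d3).
    exact: (head_missing d3 d4 d2).
  have [f13 _] := cE _ _ c13.
  by case/eqP: n23; apply: f_inj; rewrite ?o2 ?o3 // -x12.
(* The middle is an arc with halves [d2] and [d3]; the colour of its head is missing at its tail. *)
- move=> d1 d2 d3 d4 A1 A2 A3 A4 n12 n23 n34 y12 x23 y34 c13 c24.
  case o2: (o d2).
    exact: (head_missing d2 d3 d1).
  case o3: (o d3).
    by apply: (head_missing d3 d2 d4) => //; rewrite eq_sym.
  by case/eqP: n23; apply: ox; rewrite ?o2 ?o3.
Qed.

(** * A matching across a maximum cut, and maximum degree 2k+1 *)

Definition crossing (z : V -> bool) d :=
  [forall d', (px d' == px d) && (d' != d) ==> (z (py d') != z (py d))].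

(** With the fewest uncut edges, moving [v] to the other side gains nothing, so at least half of its
    half-edges cross. A half-edge without a partner counts as crossing. *)
Lemma max_cut : fiber_le 2 [set: D] px ->
  exists z : V -> bool, forall v,
    #|[set d | py d == v]| <= #|[set d | (py d == v) && crossing z d]|.*2.
Proof.
move=> /fiber_le2P x2.
pose mono (z : {ffun V -> bool}) := [set x : U | [exists d, exists d',
  [&& d != d', px d == x, px d' == x & z (py d) == z (py d')]]].
pose z0 : {ffun V -> bool} := [ffun=> true].
case: (@arg_minnP _ z0 predT (fun z => #|mono z|) isT) => z _ z_min; exists z => v.
pose N := [set d | (py d == v) && ~~ crossing z d].
pose C := [set d | (py d == v) && crossing z d].
have -> : [set d | py d == v] = N :|: C.
  by apply/setP=> d; rewrite !inE -andb_orr orNb andbT.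
apply: leq_trans (leq_card_setU _ _) _; rewrite -addnn leq_add2r.
pose z' : {ffun V -> bool} := [ffun u => if u == v then ~~ z u else z u].
have NM : px @: N \subset mono z.
  apply/subsetP=> x /imsetP[d]; rewrite inE => /andP[_ /forallPn[d']].
  rewrite negb_imply negbK => /andP[/andP[/eqP xd' nd'] zd'] ->; rewrite inE.
  by apply/existsP; exists d'; apply/existsP; exists d; rewrite nd' xd' zd' !eqxx.
(* Without loops, distinct half-edges at [v] belong to distinct edges. *)
have cN : #|px @: N| = #|N|.
  apply: card_in_imset => d d'; rewrite !inE => /andP[/eqP vd _] /andP[/eqP vd' _] x.
  by apply: pxy_inj; rewrite ?vd.
(* Moving [v] cuts the edges of [N] and can uncut only those of [C]. *)
have sub : mono z' \subset (mono z :\: px @: N) :|: px @: C.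
  apply/subsetP=> x; rewrite !inE => /existsP[d1 /existsP[d2]].
  case/and4P=> n12 /eqP x1 /eqP x2'; rewrite !ffunE.
  have crossC d d' : d != d' -> px d = x -> px d' = x -> py d = v ->
      z (py d) != z (py d') -> x \in px @: C.
    move=> ndd' xd xd' yd zd; apply/imsetP; exists d => //; rewrite inE yd eqxx /=.
    apply/forallP=> d''; apply/implyP=> /andP[/eqP xd'' nd''].
    have /or3P[] := x2 d d' d'' (in_setT _) (in_setT _) (in_setT _)
      (etrans xd (esym xd')) (esym xd'').
    - by rewrite (negbTE ndd').
    - by rewrite eq_sym (negbTE nd'').
    - by move/eqP<-; rewrite eq_sym.
  case: (eqVneq (py d1) v) => y1; case: (eqVneq (py d2) v) => y2.
  - by rewrite (pxy_inj (etrans x1 (esym x2')) (etrans y1 (esym y2))) eqxx in n12.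
  - move=> zz; rewrite (crossC d1 d2) ?orbT //.
    by move: zz; case: (z (py d1)); case: (z (py d2)).
  - move=> zz; rewrite (crossC d2 d1) ?orbT // 1?eq_sym //.
    by move: zz; case: (z (py d1)); case: (z (py d2)).
  - move=> zz; apply/orP; left; apply/andP; split.
      apply/negP=> /imsetP[d]; rewrite inE => /andP[/eqP yd _] xd.
      have /or3P[] := x2 d d1 d2 (in_setT _) (in_setT _) (in_setT _)
        (esym (etrans x1 xd)) (esym (etrans x2' xd)).
      + by move/eqP=> E; rewrite -E yd eqxx in y1.
      + by move/eqP=> E; rewrite -E yd eqxx in y2.
      + by rewrite (negbTE n12).
    apply/existsP; exists d1; apply/existsP; exists d2.
    by rewrite n12 x1 x2' zz !eqxx.
have le1 : #|mono z| <= #|mono z :\: px @: N| + #|C|.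
  apply: leq_trans (z_min z' isT) _; apply: leq_trans (subset_leq_card sub) _.
  apply: leq_trans (leq_card_setU _ _) _.
  by rewrite leq_add2l leq_imset_card.
by have := cardsID (px @: N) (mono z); rewrite (setIidPr NM) cN -/C; lia.
Qed.

Lemma crossing_matching k : 0 < k ->
  fiber_le 2 [set: D] px -> fiber_le (2 * k + 1) [set: D] py ->
  exists z : V -> bool, exists M : {set D},
    [/\ {in M, forall d, crossing z d}, {in M &, injective px},
        {in M &, injective py} & fiber_le k.*2 (~: M) py].
Proof.
move=> k_gt0 Dx Dy; have [z zP] := max_cut Dx.
pose full v := #|[set d | py d == v]| == 2 * k + 1.
pose two v := take 2 (enum [set d | (py d == v) && crossing z d]).
pose B := [set d | full (py d) && (d \in two (py d))].
have twoP v d : d \in two v -> py d = v /\ crossing z d.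
  by move/mem_take; rewrite mem_enum inE => /andP[/eqP].
have two_uniq v : uniq (two v) by rewrite take_uniq ?enum_uniq.
have By : fiber_le 2 B py.
  move=> v; apply: leq_trans (_ : size (two v) <= 2); last by rewrite size_take_min geq_minl.
  rewrite cardE; apply: uniq_leq_size; first exact: enum_uniq.
  by move=> d; rewrite mem_enum !inE => /andP[/andP[_ dB] /eqP <-].
have [c [cx cy]] := two_coloring (fiber_leS (subsetT B) Dx) By.
exists z, [set d in B | c d]; split.
- by move=> d; rewrite !inE => /andP[/andP[_ /twoP[]]].
- move=> d d'; rewrite !(inE, in_setI) => /andP[Bd cd] /andP[Bd' cd'] x.
  by apply: cx => //; rewrite ?inE ?cd.
- move=> d d'; rewrite !(inE, in_setI) => /andP[Bd cd] /andP[Bd' cd'] y.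
  by apply: cy => //; rewrite ?inE ?cd.
move=> v; have [fv|nfv] := boolP (full v); last first.
  have : #|[set d | py d == v]| <= k.*2.
    have := Dy v; rewrite /full in nfv.
    have -> : [set d in [set: D] | py d == v] = [set d | py d == v].
      by apply/setP=> d; rewrite !inE.
    by lia.
  apply: leq_trans; apply: subset_leq_card; apply/subsetP=> d.
  by rewrite !inE => /andP[].
(* A full vertex has at least [k + 1], hence two, crossing half-edges. The two chosen ones differ in
   colour, so one is in the matching, and 2k half-edges remain. *)
have [m Mm ym] : exists2 m, m \in [set d in B | c d] & py m = v.
  have sz : size (two v) = 2.
    rewrite size_take -cardE; have := zP v; rewrite (eqP fv).
    by case: ifP => //; lia.
  case E: (two v) sz (two_uniq v) => [|a [|b []]] //= _; rewrite inE andbT => nab.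
  have [ya _] : py a = v /\ crossing z a by apply: twoP; rewrite E inE eqxx.
  have [yb _] : py b = v /\ crossing z b by apply: twoP; rewrite E !inE eqxx orbT.
  have Ba : a \in B by rewrite inE ya fv E inE eqxx.
  have Bb : b \in B by rewrite inE yb fv E !inE eqxx orbT.
  case ca: (c a); first by exists a => //; rewrite inE Ba.
  exists b => //; rewrite inE Bb; case cb: (c b) => //.
  by move: nab; rewrite (cy a b) ?eqxx ?ca ?cb ?ya ?yb.
have : #|[set d | py d == v] :\ m| <= k.*2.
  by have := cardsD1 m [set d | py d == v]; rewrite (eqP fv) inE ym eqxx /=; lia.
apply: leq_trans; apply: subset_leq_card; apply/subsetP=> d.
rewrite in_set => /andP[]; rewrite in_setC => Md yd; rewrite in_setD1 in_set yd andbT.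
by apply: contraNneq Md => ->.
Qed.

Lemma star_coloring_odd k :
  fiber_le 2 [set: D] px -> fiber_le (2 * k + 1) [set: D] py ->
  exists c : D -> nat, (forall d, c d < 3 * k + 2) /\ star_coloring [set: D] c.
Proof.
(* For [k = 0] no two edges share an end in Y, so there are no alternating walks and properness at
   [px] is all that matters. *)
move=> Dx Dy; have [k0|k_gt0] := posnP k.
  have y_inj d d' : py d = py d' -> d = d'.
    have Dy1 : #|[set e in [set: D] | py e == py d]| <= 1.
      by have := Dy (py d); rewrite k0.
    by move=> y; apply: (card_le1_eqP Dy1); rewrite !inE ?y eqxx.
  have Dy2 : fiber_le 2 [set: D] py by move=> v; have := Dy v; rewrite k0; lia.
  have [c [cx cy]] := two_coloring Dx Dy2.
  exists (fun d => c d : nat); split=> [d|]; first by case: (c d); lia.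
  split.
  - move=> d d' _ _ x E; apply: cx; rewrite ?inE //.
    by move: E; case: (c d) (c d') => [] [].
  - by move=> d d' _ _ /y_inj.
  - by move=> d1 d2 d3 d4 _ _ _ _ _ n23 _ _ /y_inj E; rewrite E eqxx in n23.
  - by move=> d1 d2 d3 d4 _ _ _ _ n12 _ _ /y_inj E; rewrite E eqxx in n12.
have [z [M [zM Mx My Ay]]] := crossing_matching k_gt0 Dx Dy.
have Ax : fiber_le 2 (~: M) px := fiber_leS (subsetT _) Dx.
have [c0 [c0k [c0x c0y c0xy c0yx]]] := star_coloring_even k_gt0 Ax Ay.
pose c d := if d \in M then 3 * k + z (py d) else c0 d.
have cM d d' : c d = c d' -> (d \in M) = (d' \in M).
  by rewrite /c; have := c0k d; have := c0k d'; do 2 case: ifP => //; lia.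
have cE d d' : d \notin M -> c d = c d' -> c0 d = c0 d'.
  move=> Md E; move: (E); have := cM _ _ E; rewrite (negbTE Md) => /esym Md'.
  by rewrite /c (negbTE Md) Md'.
have MnM d1 d2 d3 : d1 \in M -> d2 \notin M -> d3 \in M ->
    px d1 = px d2 -> py d2 = py d3 -> c d1 <> c d3.
  (* As [d1] crosses the cut, the end of its partner [d2], shared with [d3], lies on the other
     side. *)
  move=> M1 M2 M3 x12 y23; rewrite /c M1 M3 => /addnI E.
  have /forallP/(_ d2)/implyP := zM _ M1; rewrite x12 eqxx y23 /=.
  rewrite (_ : d2 != d1); last by apply: contraNneq M2 => ->.
  by move/(_ isT); move: E; case: (z _) (z _) => [] [].
have free (S S' : eqType) (h : D -> S) (g : D -> S') :
    {in M &, injective h} -> {in M &, injective g} ->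
    alternating_free (~: M) h g c0 ->
    (forall d1 d2 d3, d1 \in M -> d2 \notin M -> d3 \in M ->
      h d1 = h d2 -> g d2 = g d3 -> c d1 <> c d3) ->
    alternating_free [set: D] h g c.
  move=> Mh Mg c0hg MM d1 d2 d3 d4 _ _ _ _ n12 n23 n34 h12 g23 h34 c13 c24.
  (* If both colours are new, adjacent edges lie in the matching; if one is, an edge outside joins
     two of its edges of equal colour; if none is, [c0] applies. *)
  have M13 := cM _ _ c13; have M24 := cM _ _ c24.
  case M1: (d1 \in M); rewrite M1 in M13; case M2: (d2 \in M); rewrite M2 in M24.
  - by rewrite (Mh d1 d2) ?eqxx in n12.
  - by case: (MM d1 d2 d3); rewrite ?M2.
  - by case: (MM d4 d3 d2); rewrite -?M13 -?M24.
  - apply: (c0hg d1 d2 d3 d4); rewrite ?inE ?M1 ?M2 -?M13 -?M24 //.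
      by apply: cE; rewrite ?M1.
    by apply: cE; rewrite ?M2.
have inj (S : eqType) (h : D -> S) : {in M &, injective h} ->
    fiber_inj (~: M) h c0 -> fiber_inj [set: D] h c.
  move=> Mh c0h d d' _ _ hdd' E; have := cM _ _ E; case Md: (d \in M) => Md'.
    exact: Mh.
  by apply: c0h; rewrite ?inE ?Md -?Md' //; apply: cE; rewrite ?Md.
exists c; split.
  move=> d; rewrite /c; case: ifP => _; first by case: (z _); lia.
  by have := c0k d; lia.
split; [exact: inj|exact: inj|exact: free|].
apply: free => // d1 d2 d3 M1 M2 M3 y12 x23 c13.
exact: (MnM d3 d2 d1).
Qed.

End HalfEdges.

(** * From half-edge colourings back to the graph *)

Section Transfer.
Variables (G : sgraph) (X Y : {set G}).
Hypothesis XY : bipartition X Y.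

Lemma edge_ends : exists px : edge G -> G, exists py : edge G -> G, forall e,
  [/\ px e \in X, py e \in Y, adj (px e) (py e) & val e = [set px e; py e]].
Proof.
have [_ _ XYadj] := XY.
have /fin_all_exists[p pP] (e : edge G) : exists u : G * G,
    [/\ u.1 \in X, u.2 \in Y, adj u.1 u.2 & val e = [set u.1; u.2]].
  have := valP e; rewrite inE => /existsP[x /existsP[y /andP[xy /eqP E]]].
  have /orP[/andP[Xx Yy]|/andP[Yx Xy]] := XYadj _ _ xy; first by exists (x, y).
  by exists (y, x); split; rewrite //= ?E 1?setUC // adj_sym.
by exists (fun e => (p e).1), (fun e => (p e).2).
Qed.

Lemma degree_bound (A : {set G}) n (p q : edge G -> G) :
  max_degree A <= n -> (forall e, p e \in A) -> (forall e, adj (p e) (q e)) ->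
  (forall e, val e = [set p e; q e]) -> fiber_le n [set: edge G] p.
Proof.
(* A non-empty fibre forces [v] into [A], and the other ends of its edges are distinct neighbours of
   [v]. *)
move=> An pA pq E v; have [->|[e]] := set_0Vmem [set e in [set: edge G] | p e == v].
  by rewrite cards0.
rewrite !inE => /eqP pe; have Av : v \in A by rewrite -pe pA.
apply: leq_trans (_ : degree v <= n); last first.
  by apply: leq_trans An; apply: leq_bigmax_cond.
rewrite -(@card_in_imset _ _ q).
  apply: subset_leq_card; apply/subsetP=> _ /imsetP[f + ->].
  by rewrite !inE => /eqP <-.
move=> f f'; rewrite !inE => /eqP pf /eqP pf' qq.
by apply: val_inj; rewrite !E pf pf' qq.
Qed.

Lemma star_edge_colorable_of_star_coloring (px py : edge G -> G) t
    (c : edge G -> nat) :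
  (forall e,
    [/\ px e \in X, py e \in Y, adj (px e) (py e) & val e = [set px e; py e]]) ->
  (forall e, c e < t) -> star_coloring px py [set: edge G] c ->
  star_edge_colorable G t.
Proof.
move=> pP ct [cx cy cxy cyx]; have [XYT XYd XYadj] := XY.
have notXY v : v \in X -> v \in Y -> False.
  by move=> vX vY; move/pred0P/(_ v): XYd; rewrite /= vX vY.
pose C : {ffun edge G -> 'I_t} := [ffun e => Ordinal (ct e)].
have CE e f : C e = C f -> c e = c f by rewrite !ffunE => -[].
have properC : proper_edge_coloring C.
  apply/forallP=> e; apply/forallP=> f; apply/implyP=> /andP[nef].
  case/set0Pn=> v; rewrite inE; have [Xe Ye _ ->] := pP e; have [Xf Yf _ ->] := pP f.
  rewrite !inE => /andP[ve vf]; apply: contraNneq nef => /CE cef.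
  case/orP: ve => /eqP ve; case/orP: vf => /eqP vf.
  - by rewrite (cx e f) ?inE // -ve -vf.
  - by case: (notXY v); rewrite ?[in v \in X]ve ?[in v \in Y]vf.
  - by case: (notXY v); rewrite ?[in v \in X]vf ?[in v \in Y]ve.
  - by rewrite (cy e f) ?inE // -ve -vf.
have endsX (e : edge G) u v : val e = [set u; v] -> u \in X -> v \in Y -> px e = u /\ py e = v.
  have [Xe Ye _ ->] := pP e => E Xu Yv.
  have: px e \in [set u; v] by rewrite -E !inE eqxx.
  have: py e \in [set u; v] by rewrite -E !inE eqxx orbT.
  rewrite !inE => /orP[] /eqP ye /orP[] /eqP xe //.
  - by case: (notXY u) => //; rewrite -ye.
  - by case: (notXY u) => //; rewrite -ye.
  - by case: (notXY v) => //; rewrite -xe.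
(* Paths and 4-cycles are treated at once: a cycle is the case where [p4] is [p0]. *)
have walk p0 p1 p2 p3 p4 (s : seq {set G}) :
    adj p0 p1 -> adj p1 p2 -> adj p2 p3 -> adj p3 p4 ->
    p0 != p2 -> p1 != p3 -> p2 != p4 ->
    {subset [:: [set p0; p1]; [set p1; p2]; [set p2; p3]; [set p3; p4]] <= s} ->
    ~~ (#|colors_on C s| <= 2).
  move=> a1 a2 a3 a4 n02 n13 n24 sub; rewrite -ltnNge.
  have mk u v (a : adj u v) : exists e : edge G, val e = [set u; v].
    by exists (exist (fun e => e \in edges G) _ (pair_in_edges a)).
  have [e1 E1] := mk _ _ a1; have [e2 E2] := mk _ _ a2.
  have [e3 E3] := mk _ _ a3; have [e4 E4] := mk _ _ a4.
  have Cs (e : edge G) : val e \in [:: val e1; val e2; val e3; val e4] -> C e \in colors_on C s.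
    by move=> es; apply: imset_f; rewrite inE; apply: sub; rewrite -E1 -E2 -E3 -E4.
  have s1 : C e1 \in colors_on C s by apply: Cs; rewrite !inE eqxx.
  have s2 : C e2 \in colors_on C s by apply: Cs; rewrite !inE eqxx !orbT.
  have s3 : C e3 \in colors_on C s by apply: Cs; rewrite !inE eqxx !orbT.
  have s4 : C e4 \in colors_on C s by apply: Cs; rewrite !inE eqxx !orbT.
  have step (e f : edge G) u v w : val e = [set u; v] -> val f = [set v; w] -> adj u v ->
      adj v w -> u != w -> e != f /\ C e != C f.
    move=> Ee Ef uv vw nuw.
    have nef : e != f.
      apply/eqP=> ef; have: u \in val f by rewrite -ef Ee !inE eqxx.
      rewrite Ef !inE (negbTE nuw) orbF => /eqP E.
      by rewrite E adj_irr in uv.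
    split=> //; move/forallP/(_ e)/forallP/(_ f)/implyP: properC; apply.
    rewrite nef; apply/set0Pn; exists v.
    by rewrite inE Ee Ef !inE eqxx orbT.
  have [n12 c12] := step _ _ _ _ _ E1 E2 a1 a2 n02.
  have [n23 c23] := step _ _ _ _ _ E2 E3 a2 a3 n13.
  have [n34 c34] := step _ _ _ _ _ E3 E4 a3 a4 n24.
  (* As consecutive colours differ, two colours would have to alternate along the walk. *)
  apply/card_gt2P; have [c13|c13] := eqVneq (C e1) (C e3); last first.
    by exists (C e1), (C e2), (C e3); split=> //; split=> //; rewrite eq_sym.
  exists (C e1), (C e2), (C e4); split=> //; split=> //; last first.
    by rewrite c13 eq_sym.
  apply/eqP=> /CE c24; move/CE: c13 => c13.
  have alt u v : adj u v -> u \in X -> v \in Y.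
    move=> uv Xu; have /orP[/andP[] //|/andP[Yu _]] := XYadj _ _ uv.
    by case: (notXY u).
  have alt' u v : adj u v -> u \in Y -> v \in X.
    move=> uv Yu; have /orP[/andP[Xu _]|/andP[] //] := XYadj _ _ uv.
    by case: (notXY u).
  (* The middle vertex [p2] is on the side of [p0], which decides between [cyx] and [cxy]. *)
  have /orP[X0|Y0] : (p0 \in X) || (p0 \in Y) by rewrite -in_setU XYT inE.
    have Y1 := alt _ _ a1 X0; have X2 := alt' _ _ a2 Y1.
    have Y3 := alt _ _ a3 X2; have X4 := alt' _ _ a4 Y3.
    have [x1 y1] := endsX _ _ _ E1 X0 Y1.
    have [x2 y2] := endsX _ _ _ (etrans E2 (setUC _ _)) X2 Y1.
    have [x3 y3] := endsX _ _ _ E3 X2 Y3.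
    have [x4 y4] := endsX _ _ _ (etrans E4 (setUC _ _)) X4 Y3.
    by apply: (cyx e1 e2 e3 e4); rewrite ?inE // ?y1 ?y2 ?x2 ?x3 ?y3 ?y4.
  have X1 := alt' _ _ a1 Y0; have Y2 := alt _ _ a2 X1.
  have X3 := alt' _ _ a3 Y2; have Y4 := alt _ _ a4 X3.
  have [x1 y1] := endsX _ _ _ (etrans E1 (setUC _ _)) X1 Y0.
  have [x2 y2] := endsX _ _ _ E2 X1 Y2.
  have [x3 y3] := endsX _ _ _ (etrans E3 (setUC _ _)) X3 Y2.
  have [x4 y4] := endsX _ _ _ E4 X3 Y4.
  by apply: (cxy e1 e2 e3 e4); rewrite ?inE // ?x1 ?x2 ?y2 ?y3 ?x3 ?x4.
apply/existsP; exists C; apply/and3P; split=> //.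
- apply/forallP=> x; apply/forallP=> -[[|y [|z [|w [|v []]]]] //= sz].
  apply/implyP=> /andP[/and5P[xy yz zw wv _]]; rewrite !inE !negb_or -!andbA.
  case/and5P=> _ nxz _ _ /and5P[_ nyw _ _ /and3P[nzv _ _]].
  by apply: (walk x y z w v) => // e.
- apply/forallP=> x; apply/forallP=> -[[|y [|z [|w []]]] //= sz].
  apply/implyP=> /andP[/and5P[xy yz zw wx _]]; rewrite !inE !negb_or -!andbA.
  case/and5P=> _ nxz _ _ /and3P[nyw _ _].
  by apply: (walk x y z w x) => [||||||| e] //; rewrite eq_sym.
Qed.

End Transfer.

Theorem theorem11 (k : nat) (G : sgraph) (X Y : {set G}) :
  bipartition X Y ->
  max_degree X = 2 ->
  max_degree Y = 2 * k + 1 ->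
  star_chromatic_index G <= 3 * k + 2.
Proof.
move=> XY X2 Yk; have [px [py pP]] := edge_ends XY.
have pxy_inj e f : px e = px f -> py e = py f -> e = f.
  have [_ _ _ Ee] := pP e; have [_ _ _ Ef] := pP f => x y.
  by apply: val_inj; rewrite Ee Ef x y.
have Dx : fiber_le 2 [set: edge G] px.
  by apply: (@degree_bound _ X _ px py) => [|e|e|e]; rewrite ?X2 //; case: (pP e).
have Dy : fiber_le (2 * k + 1) [set: edge G] py.
  apply: (@degree_bound _ Y _ py px) => [|e|e|e]; rewrite ?Yk //;
    case: (pP e) => // _ _; rewrite 1?adj_sym // => _ ->.
  exact: setUC.
have [c [ck cS]] := star_coloring_odd pxy_inj Dx Dy.
have ok := star_edge_colorable_of_star_coloring XY pP ck cS.
by rewrite /star_chromatic_index; case: ex_minnP => m _; apply.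
Qed.
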